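(* Let $d\ge3$, $V\ge0$, $V\in L_{p,loc}(\mathbf{R}^d)$ with some $p>d/2$, and let $Y(x,t)=\sqrt{V(x)}\,|x-t|^{-(d-2)}\sqrt{V(t)}$ for $x,t\in\mathbf{R}^d$. Suppose that there exist $r_0>0$ and a function $\gamma:(0,r_0]\to(0,1)$ with $\limsup_{r\downarrow0}r^{-2}\gamma(r)=\infty$ such that for every $r\in(0,r_0]$ $$\lim_{|y|\to\infty}V^\star\big(\gamma(r)\,\mathrm{mes}_d(Q_r(y));\,Q_r(y)\big)=\infty .$$ Then there exist $\tilde r_0>0$ and a function $\tilde\gamma:(0,\tilde r_0]\to(0,1)$ with $\limsup_{r\downarrow0}r^{-2}\tilde\gamma(r)=\infty$ such that for every $r\in(0,\tilde r_0]$ $$\lim_{|y|\to\infty}(Y^\star)^\star\big(\tilde\gamma(r)\,\mathrm{mes}_d(Q_r(y));\,Q_r(y)\big)=\infty .$$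
   Context: $\mathrm{mes}_d$ is Lebesgue measure on $\mathbf{R}^d$; $Q=[0,1]^d$, $Q_r(y)=rQ+y$. Non-increasing rearrangement on a measurable set $E\subset\mathbf{R}^d$: $W^\star(u;E)=\sup\{\tau>0:\mathrm{mes}_d(\{x\in E:W(x)\ge\tau\})\ge u\}$ ($\sup\emptyset=0$) for nonnegative measurable $W$, $u>0$. Repeated non-increasing rearrangement of a nonnegative function $F(x,t)$ integrable on $E\times E$ ($E$ of finite measure): for a.e. $t\in E$ let $F^\star(\cdot,t)(u;E)$ be the rearrangement, at $u$, of $x\mapsto F(x,t)$ on $E$; then $(F^\star)^\star(u;E)$ is the rearrangement, at $u$, of $t\mapsto F^\star(\cdot,t)(u;E)$ on $E$. (Values of $Y$ on the null set $x=t$ are irrelevant.) *)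

(* Defs.v *)
From HB Require Import structures.
From mathcomp Require Import all_boot all_order all_algebra.
From mathcomp Require Import all_classical all_reals all_analysis.

Set Implicit Arguments.
Unset Strict Implicit.
Unset Printing Implicit Defensive.
Import Order.TTheory GRing.Theory Num.Theory.
Import numFieldNormedType.Exports.

Local Open Scope classical_set_scope.
Local Open Scope ring_scope.

Section euclidean_space.
Context {R : realType} {d : nat}.
Local Notation Rd := 'rV[R]_d.

(* `|x| on 'rV[R]_d is the sup norm, hence this definition. *)
Definition enorm (x : Rd) : R := Num.sqrt (\sum_i x ord0 i ^+ 2).

(* The filter "|y| -> oo". *)
Definition enorm_infty : set_system Rd :=
  [set P | exists M : R, forall y, M < enorm y -> P y].

#[global] Instance enorm_infty_filter : Filter enorm_infty.
Proof.
split; first by exists 0.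
- move=> P Q [M MP] [N NQ]; exists (Num.max M N) => y.
  by rewrite gt_max => /andP[My Ny]; split; [exact: MP|exact: NQ].
- by move=> P Q PQ [M MP]; exists M => y /MP /PQ.
Qed.

Definition unit_cube : set Rd := [set q | forall i, 0 <= q ord0 i <= 1].

Definition cube (r : R) (y : Rd) : set Rd :=
  [set r *: q + y | q in unit_cube].

End euclidean_space.

(* Lebesgue measure on R^d: the outer measure obtained from countable coverings
   by half-open boxes, restricted to its Caratheodory-measurable sets.  A box is
   given by its two corners; None is the empty set, so that coverings may be
   finite (which matters only when d = 0, where every proper box is R^0). *)
Section lebesgue_measure_Rd.
Context {R : realType} {d : nat}.
Local Notation Rd := 'rV[R]_d.

Definition box (c : option (Rd * Rd)) : set Rd :=
  if c is Some (a, b) then [set x | forall i, a ord0 i < x ord0 i <= b ord0 i]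
  else set0.

Definition box_volume (c : option (Rd * Rd)) : R :=
  if c is Some (a, b) then \prod_i Num.max 0 (b ord0 i - a ord0 i) else 0.

Definition box_cover (A : set Rd) : set (nat -> option (Rd * Rd)) :=
  [set c | A `<=` \bigcup_k box (c k)].

Definition mes (A : set Rd) : \bar R :=
  ereal_inf [set (\sum_(k <oo) (box_volume (c k))%:E)%E | c in box_cover A].

Lemma box_volume_ge0 c : (0 <= (box_volume c)%:E)%E.
Proof.
by case: c => [[a b]|] //=; rewrite lee_fin prodr_ge0// => i _; rewrite le_max lexx.
Qed.

Lemma mes_ge0 A : (0 <= mes A)%E.
Proof.
apply: le_ereal_inf_tmp => x [c _ <-].
by apply: nneseries_ge0 => n _ _; exact: box_volume_ge0.
Qed.

Lemma le_mes : {homo mes : A B / A `<=` B >-> (A <= B)%E}.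
Proof.
move=> A B AB; apply/ereal_inf_le_tmp => x [c Bc <-].
by exists c => //; apply: subset_trans AB Bc.
Qed.

Lemma mes0 : mes set0 = 0%E.
Proof.
apply/eqP; rewrite eq_le mes_ge0 andbT.
apply: ereal_inf_lbound; exists (fun=> None); first exact: sub0set.
by rewrite eseries0.
Qed.

Lemma mes_sigma_subadditive : sigma_subadditive mes.
Proof.
move=> A; have [[i ioo]|] := pselect (exists i, mes (A i) = +oo%E).
  rewrite (eseries_pinfty _ _ ioo) ?leey// => n _.
  by rewrite -ltNye (lt_le_trans _ (mes_ge0 _)).
rewrite -forallNE => Aoo.
apply/lee_addgt0Pr => _/posnumP[e].
rewrite (le_trans _ (epsilon_trick _ _ _))//; last by move=> n; exact: mes_ge0.
pose P n c := box_cover (A n) c /\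
  (\sum_(k <oo) (box_volume (c k))%:E <=
   mes (A n) + (e%:num / (2 ^ n.+1)%:R)%:E)%E.
have [G PG] : {G : nat -> nat -> option (Rd * Rd) & forall n, P n (G n)}.
  apply: (@choice _ _ P) => n; rewrite /P.
  have en1 : 0 < e%:num / (2 ^ n.+1)%:R :> R by [].
  have fA : mes (A n) \is a fin_num.
    by rewrite ge0_fin_numE ?mes_ge0// ltey; apply/eqP.
  have [_ [c Ac <-] /ltW cA] := lb_ereal_inf_adherent en1 fA.
  by exists c.
pose v (ij : nat * nat) := (box_volume (G ij.1 ij.2))%:E.
have v_ge0 x : (0 <= v x)%E by exact: box_volume_ge0.
apply: (@le_trans _ _ (\esum_(i in setT) v i)%E).
  apply: ereal_inf_lbound => /=.
  have /card_esym/ppcard_eqP[f] := card_nat2.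
  exists (fun k => G (f k).1 (f k).2).
    move=> t [i _ /(PG i).1 [j _ Gt]].
    by exists (f^-1%FUN (i, j)) => //; rewrite invK ?inE.
  rewrite -(esum_pred_image v _ xpredT) ?[fun=> _]set_true//.
  by rewrite image_eq.
rewrite (_ : esum _ _ =
    \sum_(i <oo) \sum_(j <oo) (box_volume (G i j))%:E)%E; last first.
  pose J : nat -> set (nat * nat) := fun i => [set (i, j) | j in setT].
  rewrite (_ : setT = \bigcup_k J k); last first.
    by rewrite predeqE => -[a b]; split => // _; exists a => //; exists b.
  rewrite esum_bigcupT //=; last first.
    apply/trivIsetP => i j _ _ ij.
    rewrite predeqE => -[n m] /=; split => //= -[] [_] _ [<-{n} _].
    by move=> [m' _] [] /esym/eqP; rewrite (negbTE ij).
  rewrite -(image_id [set: nat]) -fun_true esum_pred_image//; last first.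
    by move=> n _; exact: esum_ge0.
  apply: eq_eseriesr => /= j _.
  rewrite -(esum_pred_image v (pair j) predT)//=; last first.
    by move=> ? ? _ _; exact: (@can_inj _ _ _ snd).
  by congr esum; rewrite predeqE => -[a b]; split; move=> [i _ <-]; exists i.
apply: lee_nneseries => [n _ _|n _]; last exact: (PG n).2.
by apply: nneseries_ge0 => m _ _; exact: box_volume_ge0.
Qed.

HB.instance Definition _ :=
  isOuterMeasure.Build R Rd mes mes0 mes_ge0 le_mes mes_sigma_subadditive.

End lebesgue_measure_Rd.

(* R^d equipped with the sigma-algebra of Lebesgue measurable sets. *)
Notation measRd R d := (caratheodory_type (@mes R d)).

Section locally_Lp.
Context {R : realType} {d : nat}.

Definition Lp_loc (p : R) (V : 'rV[R]_d -> R) : Prop :=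
  measurable_fun [set: measRd R d] (V : measRd R d -> R) /\
  forall K : set 'rV[R]_d, compact K ->
    (\int[(@mes R d : set (measRd R d) -> \bar R)]_(x in K)
       (`|V x| `^ p)%:E < +oo)%E.

End locally_Lp.

Section rearrangement.
Context {R : realType} {d : nat}.
Local Notation Rd := 'rV[R]_d.
Implicit Type E : set Rd.

(* The element 0 realizes the convention "sup of the empty set = 0". *)
Definition rearr (W : Rd -> \bar R) E (u : \bar R) : \bar R :=
  ereal_sup ([set 0%E] `|` [set tau%:E | tau in [set tau : R |
    0 < tau /\ (u <= mes [set x | E x /\ (tau%:E <= W x)%E])%E]]).

Definition rearr2 (F : Rd -> Rd -> R) E (u : \bar R) : \bar R :=
  rearr (fun t => rearr (fun x => (F x t)%:E) E u) E u.

(* On the diagonal x = t the value is 0, since 0^-1 = 0. *)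
Definition kernelY (V : Rd -> R) (x t : Rd) : R :=
  Num.sqrt (V x) * enorm (x - t) ^- (d - 2) * Num.sqrt (V t).

End rearrangement.

(* Main.v *)
Require Import Defs.
From HB Require Import structures.
From mathcomp Require Import all_boot all_order all_algebra.
From mathcomp Require Import all_classical all_reals all_analysis.
From mathcomp Require Import lra.
Import Order.TTheory GRing.Theory Num.Theory.
Import numFieldNormedType.Exports.
Local Open Scope classical_set_scope.
Local Open Scope ring_scope.

(** Two points of a cube of side [r] are at distance at most
    [L = sqrt d * r], so off the diagonal
    [Y(x,t) >= L^-(d-2) sqrt (V x) sqrt (V t)] there.  If the superlevel set
    [A = {V >= tau}] of the cube has measure at least [u], then for each [t] in
    [A] the function [Y(., t)] is at least [L^-(d-2) tau] on [A] minus the point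
    [t], which has the same measure as [A] because points are null.  Hence the
    inner rearrangement at [u] is at least [L^-(d-2) tau] on all of [A], and so
    is the repeated one ([le_rearr2_kernelY]).  Since [L] depends on [r] but not
    on [y], the conclusion holds with the same radius and the same function
    [gamma]. *)

Section lebesgue_points.
Context {R : realType} {d : nat}.
Implicit Types (A : set 'rV[R]_d) (t : 'rV[R]_d).

Lemma mes_set1 t : (0 < d)%N -> mes [set t] = 0%E.
Proof.
move=> d0; apply/eqP; rewrite eq_le mes_ge0 andbT.
apply/lee_addgt0Pr => e e0; rewrite add0e.
(* A single box with corner [t] and edge [f <= 1] has volume
   [f ^+ d <= f <= e], as [0 < d]. *)
pose f := Num.min e 1.
have f0 : 0 < f by rewrite lt_min e0 ltr01.
pose c k : option ('rV[R]_d * 'rV[R]_d) :=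
  if k is 0%N then Some (t - const_mx f, t) else None.
have ct : box_cover [set t] c.
  by move=> _ ->; exists 0%N => // i; rewrite !mxE lexx andbT ltrBlDr ltrDl.
apply: (@le_trans _ _ (\sum_(k <oo) (box_volume (c k))%:E)%E).
  by apply: ereal_inf_lbound; exists c.
rewrite (nneseries_split 0%N 1%N); last by move=> k _; exact: box_volume_ge0.
rewrite add0n big_nat1 eseries0 ?adde0; last by case.
rewrite lee_fin /= (eq_bigr (fun=> f)); last first.
  by move=> i _; rewrite !mxE opprB addrC subrK max_r// ltW.
rewrite prodr_const card_ord (@le_trans _ _ f) //; last by rewrite ge_min lexx.
by apply: ler_iXnr => //; [exact: ltW|rewrite ge_min lexx orbT].
Qed.

Lemma le_mesD1 A t : (0 < d)%N -> (mes A <= mes (A `\ t))%E.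
Proof.
move=> d0; rewrite -[leRHS]adde0 -(mes_set1 t d0).
apply: (le_trans _ (outer_measureU2 (@mes R d) _ _)).
by apply: le_mes => x Ax; have [->|/eqP xt] := eqVneq x t; [right|left].
Qed.

End lebesgue_points.

Section euclidean_norm.
Context {R : realType} {d : nat}.
Implicit Types x y : 'rV[R]_d.

Lemma enorm_gt0 x : x != 0 -> 0 < enorm x.
Proof.
move=> x0; rewrite sqrtr_gt0 lt_neqAle sumr_ge0 ?andbT; last first.
  by move=> i _; exact: sqr_ge0.
apply: contra x0; rewrite eq_sym psumr_eq0; last by move=> i _; exact: sqr_ge0.
move=> /allP x0; apply/eqP/rowP => i; rewrite mxE; apply/eqP.
by rewrite -sqrf_eq0; apply: x0; rewrite mem_index_enum.
Qed.

Lemma cube_enorm_le (r : R) y x t : 0 <= r -> cube r y x -> cube r y t ->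
  enorm (x - t) <= Num.sqrt d%:R * r.
Proof.
move=> r0 [a a1 <-] [b b1 <-].
rewrite -[in leRHS](ger0_norm r0) -sqrtr_sqr -sqrtrM// ler_wsqrtr//.
rewrite mulr_natl -[in leRHS](card_ord d) -sumr_const; apply: ler_sum => i _.
rewrite !mxE opprD addrACA subrr addr0 -mulrBr exprMn ler_piMr ?sqr_ge0//.
rewrite -real_normK ?num_real// expr_le1// ler_norml.
have /andP[? ?] := a1 i; have /andP[? ?] := b1 i.
by apply/andP; split; lra.
Qed.

End euclidean_norm.

Section rearrangement_bounds.
Context {R : realType} {d : nat}.
Implicit Types (W : 'rV[R]_d -> \bar R) (E : set 'rV[R]_d) (u : \bar R).

Lemma le_rearr W E u (tau : R) : 0 < tau ->
  (u <= mes [set x | E x /\ (tau%:E <= W x)%E])%E -> (tau%:E <= rearr W E u)%E.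
Proof. by move=> tau0 u_le; apply: ereal_sup_ubound; right; exists tau. Qed.

Lemma lt_rearr W E u (tau : R) : 0 <= tau -> (tau%:E < rearr W E u)%E ->
  (u <= mes [set x | E x /\ (tau%:E <= W x)%E])%E.
Proof.
move=> tau0 /ereal_sup_gt[_ [->|[s [s0 u_le] <-]]].
  by rewrite lte_fin ltNge tau0.
rewrite lte_fin => tau_s; apply: (le_trans u_le); apply: le_mes => x [Ex sW].
by split=> //; apply: le_trans sW; rewrite lee_fin ltW.
Qed.

Lemma le_rearr2_kernelY (V : 'rV[R]_d -> R) E u (L tau : R) :
  (0 < d)%N -> 0 < L ->
  (forall x t, E x -> E t -> enorm (x - t) <= L) ->
  0 < tau -> (tau%:E < rearr (fun x => (V x)%:E) E u)%E ->
  ((L ^- (d - 2) * tau)%:E <= rearr2 (kernelY V) E u)%E.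
Proof.
move=> d0 L0 EL tau0 tauV.
have u_le := lt_rearr _ _ _ _ (ltW tau0) tauV.
have Ltau0 : 0 < L ^- (d - 2) * tau by rewrite mulr_gt0// invr_gt0 exprn_gt0.
apply: le_rearr => //; apply: (le_trans u_le); apply: le_mes => t [Et tVt].
split=> //; apply: le_rearr => //.
apply: (le_trans u_le); apply: (le_trans (le_mesD1 _ t d0)).
apply: le_mes => x [[Ex tVx] /eqP xt]; split=> //.
move: tVx tVt; rewrite !lee_fin => tVx tVt.
have xt0 : 0 < enorm (x - t) by rewrite enorm_gt0// subr_eq0.
rewrite /kernelY mulrAC [leRHS]mulrC ler_pM//.
- by rewrite invr_ge0 exprn_ge0// ltW.
- exact: ltW.
- by rewrite lef_pV2 ?posrE ?exprn_gt0// lerXn2r// ?nnegrE;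
    [exact: ltW|exact: ltW|exact: EL].
- rewrite -[leLHS](sqr_sqrtr (ltW tau0)) expr2.
  by rewrite ler_pM ?sqrtr_ge0// ler_wsqrtr.
Qed.

End rearrangement_bounds.

Theorem proposition4p8 (R : realType) (d : nat) (hd : (3 <= d)%N)
  (V : 'rV[R]_d -> R) (V_ge0 : forall x, 0 <= V x)
  (p : R) (hp : d%:R / 2 < p) (V_Lp : Lp_loc p V)
  (hV : exists (r0 : R) (gamma : R -> R),
    [/\ 0 < r0,
        forall r : R, 0 < r <= r0 -> 0 < gamma r < 1,
        limf_esup (fun r : R => (r ^- 2 * gamma r)%:E) 0^'+ = +oo%E &
        forall r : R, 0 < r <= r0 ->
          rearr (fun x => (V x)%:E) (cube r y)
            ((gamma r)%:E * mes (cube r y))%E @[y --> enorm_infty] --> +oo%E]) :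
  exists (r1 : R) (gamma1 : R -> R),
    [/\ 0 < r1,
        forall r : R, 0 < r <= r1 -> 0 < gamma1 r < 1,
        limf_esup (fun r : R => (r ^- 2 * gamma1 r)%:E) 0^'+ = +oo%E &
        forall r : R, 0 < r <= r1 ->
          rearr2 (kernelY V) (cube r y)
            ((gamma1 r)%:E * mes (cube r y))%E @[y --> enorm_infty] --> +oo%E].
Proof.
have d0 : (0 < d)%N by exact: leq_trans hd.
case: hV => r0 [gamma [r0_gt0 gamma01 gamma_sup V_cvg]].
exists r0, gamma; split=> // r rr0; have /andP[r_gt0 _] := rr0.
have L0 : 0 < Num.sqrt d%:R * r by rewrite mulr_gt0// sqrtr_gt0 ltr0n.
apply/cvgeyPge => A.
have /cvgeyPgt V_gt := V_cvg r rr0.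
(* The level [tau] is chosen so that [L^-(d-2) tau >= A]. *)
pose tau := (Num.sqrt d%:R * r) ^+ (d - 2) * Num.max A 1.
have Ld0 : 0 < (Num.sqrt d%:R * r) ^+ (d - 2) by rewrite exprn_gt0.
have tau0 : 0 < tau by rewrite mulr_gt0// lt_max ltr01 orbT.
apply: filterS (V_gt tau) => y tauV.
have := le_rearr2_kernelY V _ _ _ _ d0 L0
  (fun x t => cube_enorm_le r y x t (ltW r_gt0)) tau0 tauV.
by apply: le_trans; rewrite mulKf ?gt_eqF// lee_fin le_max lexx.
Qed.
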